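(* Let $P$ be an ARB Markov kernel with invariant probability measure $\Pi$ supported on $\Theta$ and acceptance probability $A(\cdot)$. If $P$ is $(\rho,M)$-geometrically ergodic, then $$\rho\ \ge\ 1-\inf_{\theta\in\Theta}A(\theta).$$
   Context: $\Omega$ is a nonempty Borel measurable space with Borel sigma-algebra $\mathcal{B}(\Omega)$. $\Pi$ is a probability measure on $(\Omega,\mathcal{B}(\Omega))$ supported on a nonempty measurable set $\Theta\subseteq\Omega$, having density $\pi$ with respect to a sigma-finite measure $\lambda$ on $(\Omega,\mathcal{B}(\Omega))$; the support of $\pi$ is $\Theta$, so $\pi(\theta)>0$ for each $\theta\in\Theta$. For each $\theta\in\Theta$, $\{\theta\}$ is Borel measurable with $\lambda(\{\theta\})=0$, and $\lambda$ is strictly positive: $\lambda(U)>0$ for all nonempty measurable open sets $U\subseteq\Theta$. ARB kernel: for each $\theta\in\Omega$, $Q(\theta,\cdot)$ is a proposal distribution on $(\Omega,\mathcal{B}(\Omega))$ with density $q(\theta,\cdot)$ with respect to $\lambda$. Given an acceptance function $a:\Omega\times\Omega\to[0,1]$, the acceptance probability is $A(\theta)=\int a(\theta,\theta')q(\theta,\theta')\,d\lambda(\theta')$, and the ARB Markov kernel is $$P(\theta,B)=\int_B a(\theta,\theta')q(\theta,\theta')\,d\lambda(\theta')+\delta_\theta(B)[1-A(\theta)],\qquad \theta\in\Omega,\ B\in\mathcal{B}(\Omega),$$ where $\delta_\theta$ is the Dirac measure at $\theta$. It is assumed that $a$ is such that $\Pi$ is invariant for $P$ (reversibility is not assumed).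 $P^t$ denotes the $t$-step kernel, $P^1=P$. Total variation: $\|\mu-\nu\|_{\mathrm{TV}}=\sup_f\left[\int f\,d\mu-\int f\,d\nu\right]$, the supremum over Borel measurable $f:\Omega\to[0,1]$. $P$ is $(\rho,M)$-geometrically ergodic if $\rho\in(0,1)$ and $M:\Theta\to(0,\infty)$ are such that $\|P^t(\theta,\cdot)-\Pi\|_{\mathrm{TV}}\le M(\theta)\rho^t$ for every $\theta\in\Theta$ and every positive integer $t$. *)

(* Defs.v *)
From HB Require Import structures.
From mathcomp Require Import all_boot all_order all_algebra.
From mathcomp Require Import all_classical all_reals all_analysis.
Set Implicit Arguments.
Unset Strict Implicit.
Unset Printing Implicit Defensive.
Import Order.TTheory GRing.Theory Num.Theory.
Import numFieldNormedType.Exports.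

Local Open Scope classical_set_scope.
Local Open Scope ring_scope.
Local Open Scope ereal_scope.

(* The carrier is [T] itself, so a subset can be tested both with [open] (at
   type [set T]) and with [measurable] (at type [set (borelType T)]). *)
Notation borelType T := (g_sigma_algebraType (@open T)).

Section markov.
Context d (T : measurableType d) (R : realType).
Implicit Types (mu nu : {measure set T -> \bar R}) (P : R.-pker T ~> T).

Definition has_density mu nu (f : T -> R) :=
  [/\ measurable_fun setT f, forall x, (0 <= f x)%R &
      forall B, measurable B -> nu B = \int[mu]_(x in B) (f x)%:E].

Definition tv_dist mu nu : \bar R :=
  ereal_sup [set \int[mu]_x (f x)%:E - \int[nu]_x (f x)%:E | f in
    [set f : T -> R | measurable_fun setT f /\ forall x, (0 <= f x <= 1)%R]].

Fixpoint kernel_pow P (t : nat) : R.-spker T ~> T :=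
  if t is t'.+1 then mkcomp_noparam (kernel_pow P t') P
  else kdirac (@measurable_id _ T setT).

Lemma kernel_pow1 P x B : measurable B -> kernel_pow P 1 x B = P x B.
Proof.
move=> mB; rewrite /= /mkcomp_noparam /kcomp_noparam /= /kdirac.
rewrite integral_dirac//; first by rewrite diracT mul1e.
exact: measurable_kernel.
Qed.

Definition invariant_measure (Pi : probability T R) P :=
  forall B, measurable B -> Pi B = \int[Pi]_x P x B.

Definition geometrically_ergodic (Pi : probability T R) (Theta : set T) P
    (rho : R) (M : T -> R) :=
  [/\ (0 < rho < 1)%R, forall x, Theta x -> (0 < M x)%R &
      forall x t, Theta x -> (0 < t)%N ->
        tv_dist (kernel_pow P t x) Pi <= (M x * rho ^+ t)%:E].

Definition acceptance_prob mu (a q : T -> T -> R) (x : T) : \bar R :=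
  \int[mu]_y (a x y * q x y)%:E.

Definition arb mu (a q : T -> T -> R) (x : T) (B : set T) : \bar R :=
  \int[mu]_(y in B) (a x y * q x y)%:E
  + \d_x B * (1 - acceptance_prob mu a q x).

End markov.

(* Main.v *)
Require Import Defs.
From HB Require Import structures.
From mathcomp Require Import all_boot all_order all_algebra.
From mathcomp Require Import all_classical all_reals all_analysis.
From mathcomp Require Import measurable_realfun.
Import Order.TTheory GRing.Theory Num.Theory.
Import numFieldNormedType.Exports.

Local Open Scope classical_set_scope.
Local Open Scope ring_scope.
Local Open Scope ereal_scope.

(** The chain started at [x] can sit at [x] for [t] steps by rejecting every
    proposal, so [P^t(x, {x}) >= P(x, {x})^t >= (1 - A(x))^t].  The density of
    [Pi] makes the point [x] null under [Pi], so the indicator of [{x}] is a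
    test function showing that the total variation distance between
    [P^t(x, .)] and [Pi] is at least [(1 - A(x))^t].  Geometric ergodicity then
    gives [(1 - A(x))^t <= M(x) rho^t] for all [t > 0], and letting [t] grow
    forces [1 - A(x) <= rho]: the constant [M(x)] may depend on [x], but the
    rate does not, so the bound survives taking the infimum over [x].

    The first step is [expe_kernel_pow_set1], the second [sub_le_tv_dist], and
    they combine in [geometrically_ergodic_holding], which concerns any Markov
    kernel; only [rejection_le_arb] looks at the accept-reject form. *)

(** Otherwise the quotient [(c / r)^t], which is at least [1 / m], would tend
    to zero. *)
Lemma geometric_bound_base (R : realType) (r c m : R) : (0 < c)%R ->
  (forall t, (0 < t)%N -> (r ^+ t <= m * c ^+ t)%R) -> (r <= c)%R.
Proof.
move=> c0 rcm; rewrite leNgt; apply/negP => cr.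
have r0 : (0 < r)%R := lt_trans c0 cr.
have z1 : (`|c / r| < 1)%R.
  by rewrite ger0_norm ?divr_ge0 ?ltW// ltr_pdivrMr// mul1r.
have /cvgrPdist_lt/(_ 1%R ltr01)[N _ small] := cvg_geometric m z1.
have := small N.+1 (leqnSn N); rewrite /geometric /= sub0r normrN; apply/negP.
rewrite -leNgt (le_trans _ (ler_norm _))// expr_div_n mulrA.
by rewrite ler_pdivlMr ?exprn_gt0// mul1r rcm.
Qed.

Lemma sub_le_tv_dist d (T : measurableType d) (R : realType)
    (mu nu : {measure set T -> \bar R}) (B : set T) :
  measurable B -> mu B - nu B <= tv_dist mu nu.
Proof.
move=> mB; apply: ereal_sup_ubound; exists (\1_B : T -> R).
  split; first exact: measurable_indic.
  by move=> x; rewrite indicE; case: (x \in B); rewrite ?ler01 ?lexx.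
by rewrite !integral_indic// !setIT.
Qed.

(** Among the paths of length [t] from [x] to [x] is the one that never
    leaves [x]. *)
Lemma expe_kernel_pow_set1 d (T : measurableType d) (R : realType)
    (P : R.-pker T ~> T) (x : T) (t : nat) : measurable [set x] ->
  P x [set x] ^+ t <= kernel_pow P t x [set x].
Proof.
move=> mx; elim: t => [|t IH].
  by rewrite expe0 /= /kdirac /= diracE mem_set.
rewrite expeS; apply: (@le_trans _ _ (P x [set x] * kernel_pow P t x [set x])).
  exact: lee_wpmul2l.
rewrite -integral_cst// [leRHS]/=.
rewrite [leLHS](_ : _ = \int[kernel_pow P t x]_(y in [set x]) P y [set x]); last first.
  by apply: eq_integral => y; rewrite inE /= => ->.
apply: ge0_subset_integral => //.
exact: measurable_kernel.
Qed.

(** A geometric rate cannot beat the probability of staying put at a point that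
    the limit does not charge. *)
Lemma geometrically_ergodic_holding d (T : measurableType d) (R : realType)
    (P : R.-pker T ~> T) (Pi : probability T R) (Theta : set T)
    (rho : R) (M : T -> R) (x : T) :
  geometrically_ergodic Pi Theta P rho M -> Theta x ->
  measurable [set x] -> Pi [set x] = 0 -> P x [set x] <= rho%:E.
Proof.
move=> [/andP[rho0 _] _ ergodic] Tx mx Pix0.
have Pfin : P x [set x] \is a fin_num.
  rewrite ge0_fin_numE// (@le_lt_trans _ _ 1) ?ltry//.
  by rewrite -(@prob_kernel _ _ _ _ _ P x) le_measure ?inE.
rewrite -(fineK Pfin) lee_fin; apply: (geometric_bound_base _ _ _ (M x)) => // t t0.
rewrite -lee_fin EFin_expe fineK//.
apply: le_trans (ergodic x t Tx t0).
apply: le_trans (expe_kernel_pow_set1 _ _ _ _ _ _ mx) _.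
by rewrite -[leLHS]sube0 -Pix0; exact: sub_le_tv_dist.
Qed.

Lemma has_density_null d (T : measurableType d) (R : realType)
    (mu nu : {measure set T -> \bar R}) (f : T -> R) (B : set T) :
  has_density mu nu f -> measurable B -> mu B = 0 -> nu B = 0.
Proof.
move=> [mf _ nuE] mB muB0; rewrite nuE// null_set_integral//.
by apply/measurable_EFinP; apply: measurable_funTS.
Qed.

Lemma rejection_le_arb d (T : measurableType d) (R : realType)
    (mu : {measure set T -> \bar R}) (a q : T -> T -> R) (x : T) :
  (forall y, 0 <= a x y * q x y)%R ->
  1 - acceptance_prob mu a q x <= arb mu a q x [set x].
Proof.
move=> aq0; rewrite /arb diracE mem_set// mul1e leeDr//.
by apply: integral_ge0 => y _; rewrite lee_fin.
Qed.

Theorem theorem2 (R : realType) (Omega : ptopologicalType)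
  (lambda : {sigma_finite_measure set (borelType Omega) -> \bar R})
  (Pi : probability (borelType Omega) R)
  (Theta : set (borelType Omega))
  (pi : borelType Omega -> R)
  (Theta_measurable : measurable Theta)
  (Theta_nonempty : Theta !=set0)
  (Pi_Theta : Pi Theta = 1)
  (Pi_density : has_density lambda Pi pi)
  (pi_support : [set x | pi x != 0%R] = Theta)
  (points_measurable : forall x, Theta x -> measurable [set x])
  (lambda_points : forall x, Theta x -> lambda [set x] = 0)
  (lambda_positive : forall U : set Omega, open U ->
     measurable (U : set (borelType Omega)) ->
     U !=set0 -> U `<=` Theta -> 0 < lambda U)
  (Q : borelType Omega -> probability (borelType Omega) R)
  (q : borelType Omega -> borelType Omega -> R)
  (Q_density : forall x, has_density lambda (Q x) (q x))
  (a : borelType Omega -> borelType Omega -> R)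
  (a_measurable : forall x, measurable_fun setT (a x))
  (a_bounds : forall x y, (0 <= a x y <= 1)%R)
  (P : R.-pker (borelType Omega) ~> (borelType Omega))
  (P_arb : forall x B, measurable B -> P x B = arb lambda a q x B)
  (P_invariant : invariant_measure Pi P)
  (rho : R) (M : borelType Omega -> R)
  (P_ergodic : geometrically_ergodic Pi Theta P rho M) :
  rho%:E >= 1 - ereal_inf [set acceptance_prob lambda a q x | x in Theta].
Proof.
have rejection x : Theta x -> 1 - acceptance_prob lambda a q x <= rho%:E.
  move=> Tx; have mx := points_measurable x Tx.
  have Pix0 : Pi [set x] = 0.
    exact: has_density_null _ _ _ _ _ _ _ Pi_density mx (lambda_points x Tx).
  apply: le_trans (geometrically_ergodic_holding _ _ _ _ _ _ _ _ _ P_ergodic Tx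
    mx Pix0).
  rewrite P_arb//; apply: rejection_le_arb => y.
  have [/andP[a0 _] [_ q0 _]] := (a_bounds x y, Q_density x).
  exact: mulr_ge0.
(* Moving [rho] rather than the infimum across the inequalities avoids showing
   that the infimum is finite. *)
rewrite lee_subel_addr// -leeBlDl//.
apply: le_ereal_inf_tmp => _ [x Tx <-].
by rewrite leeBlDl// -lee_subel_addr// rejection.
Qed.
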